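(* If $(H,\pi)$ is an elementary homomorphic image of a signed graph $(G,\sigma)$, then $$\psi(G,\sigma)-4\le\psi(H,\pi)\le\psi(G,\sigma).$$ Furthermore, the lower bound can be attained; in particular, for every integer $k\ge8$ there exist a signed graph $(G,\sigma)$ with $\psi(G,\sigma)=k$ and an elementary homomorphic image $(H,\pi)$ of it with $\psi(H,\pi)=k-4$.
   Context: A signed graph $(G,\sigma)$ is a finite simple graph $G$ with a signature $\sigma:E(G)\to\{-,+\}$. Switching a set $S\subseteq V(G)$ changes the sign of every edge with exactly one end in $S$; two signed graphs on the same underlying graph are equivalent if one is obtained from the other by switching some set of vertices. For $k\ge1$ let $M_k=\{-n,\dots,-1,+1,\dots,+n\}$ if $k=2n$, and $M_k=\{-n,\dots,-1,\pm0,+1,\dots,+n\}$ if $k=2n+1$, where $\pm0$ is a single colour with $-(\pm0)=\pm0$. A $k$-colouring of $(G,\sigma)$ is a map $\phi:V(G)\to M_k$. Let $K_k^*$ be the signed multigraph with vertex set $\{i\ge 0: +i\in M_k\}$ (vertex $0$ standing for colour $\pm0$ when $k$ is odd), in which every two distinct vertices are joined by exactly one positive and one negative edge, and every vertex $i\neq0$ carries exactly one negative loop. Given a $k$-colouring $\phi$, the reduced signed graph $R(G,\sigma,\phi)$ is obtained by (1) switching every vertex with a negative colour $-i$ and recolouring it $+i$; (2) identifying, for each $i$, all vertices of colour $+i$ (resp. $\pm0$) into a single vertex $i$ (resp. $0$), edges inside a class becoming loops; (3) keeping at most one positive and at most one negative edge (or loop) between any two vertices (or at any vertex). The colouring $\phi$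 is complete if $R(G,\sigma,\phi)$ is exactly $K_k^*$. The achromatic number $\psi(G,\sigma)$ is the largest $k\ge1$ such that some signed graph equivalent to $(G,\sigma)$ admits a complete $k$-colouring. Two vertices $u,v$ of $(G,\sigma)$ are identifiable if they are non-adjacent and, after possibly switching $u$ or $v$, $\sigma(uw)=\sigma(vw)$ for every common neighbour $w$ of $u$ and $v$. An elementary homomorphic image of $(G,\sigma)$ is the signed graph obtained from $(G,\sigma)$ (after this possible switching) by identifying two identifiable vertices $u,v$ into a single vertex adjacent to all neighbours of $u$ and of $v$, each such edge keeping its sign (the result being simple). *)

(* Defs.v *)
From mathcomp Require Import all_boot all_order all_algebra.
From mathcomp Require Import boolp.
Set Implicit Arguments.
Unset Strict Implicit.
Unset Printing Implicit Defensive.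

(* [sg_neg u v] is the sign of the edge uv: true for -, false for +.  Its
   values on non-adjacent pairs are junk, never inspected below.  *)
Record sgraph := SGraph {
  sg_vert :> finType;
  sg_adj : rel sg_vert;
  sg_neg : sg_vert -> sg_vert -> bool;
  sg_adj_sym : symmetric sg_adj;
  sg_adj_irr : irreflexive sg_adj;
  sg_neg_sym : forall u v, sg_adj u v -> sg_neg u v = sg_neg v u
}.

Section Switching.
Variables (G : sgraph) (S : {set G}).

Definition switch_neg (u v : G) : bool :=
  ((u \in S) (+) (v \in S)) (+) sg_neg u v.

Lemma switch_neg_sym u v : sg_adj u v -> switch_neg u v = switch_neg v u.
Proof. by move=> uv; rewrite /switch_neg (addbC (u \in S)) sg_neg_sym. Qed.

Definition switch : sgraph :=
  SGraph (@sg_adj_sym G) (@sg_adj_irr G) switch_neg_sym.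
End Switching.

(* The colours are integers, the colour ±0 being the integer 0. *)
Definition M (k : nat) : pred int :=
  [pred c | (`|c| <= k./2)%N && ((c != 0%R) || odd k)].

Definition colouring (G : sgraph) (k : nat) (phi : G -> int) : Prop :=
  forall v, phi v \in M k.

(* Signed multigraphs on natural numbers with at most one positive and at most
   one negative edge between two vertices, and at most one positive and at most
   one negative loop at a vertex: [mg_edge s i j] tells whether the edge (the
   loop if i = j) of sign s is present, with true for -.  *)
Record smgraph := SMGraph {
  mg_vert : pred nat;
  mg_edge : bool -> rel nat
}.

Definition smgraph_eq (A B : smgraph) : Prop :=
  mg_vert A =1 mg_vert B /\ forall s, mg_edge A s =2 mg_edge B s.

Definition Kstar (k : nat) : smgraph := {|
  mg_vert := fun i => Posz i \in M k;
  mg_edge := fun s i j =>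
    [&& Posz i \in M k, Posz j \in M k & (i == j) ==> (s && (i != 0))]
|}.

(* After switching the vertices of negative colour, the vertex v is recoloured
   by the absolute value of its colour.  *)
Definition reduced (G : sgraph) (phi : G -> int) : smgraph :=
  let G' := switch [set v : G | (phi v < 0)%R] in
  let c (v : G') : nat := `|phi v|%N in
  {| mg_vert := fun i => [exists v : G', c v == i];
     mg_edge := fun s i j =>
       [exists u : G', exists v : G',
          [&& sg_adj u v, sg_neg u v == s, c u == i & c v == j]] |}.

Definition complete_colouring (G : sgraph) (k : nat) (phi : G -> int) : Prop :=
  colouring k phi /\ smgraph_eq (reduced phi) (Kstar k).

Definition admits_complete (G : sgraph) (k : nat) : Prop :=
  exists (S : {set G}) (phi : switch S -> int), complete_colouring k phi.

(* The range of k is no restriction: see [psi_max]. *)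
Definition psi (G : sgraph) : nat :=
  \max_(k < (#|G|.*2).+2 | (0 < k) && `[< admits_complete G k >]) k.

Lemma admits_complete_bound (G : sgraph) k :
  admits_complete G k -> k < (#|G|.*2).+2.
Proof.
case=> S [phi [_ [Hv _]]].
suff H : k./2 <= #|G|.
  by rewrite -{1}(odd_double_half k) ltnS -add1n leq_add ?leq_b1 // leq_double.
have sub : {subset iota 1 k./2 <= [seq `|phi v|%N | v <- enum G]}.
  move=> i; rewrite mem_iota add1n ltnS => /andP[i0 ik].
  have: mg_vert (Kstar k) i by rewrite /= inE /= ik eqz_nat -lt0n i0.
  rewrite -Hv => /existsP[v /eqP <-]; apply/mapP.
  by exists v => //; rewrite mem_enum.
have := uniq_leq_size (iota_uniq 1 k./2) sub.
by rewrite size_iota size_map -cardE.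
Qed.

Lemma psi_max (G : sgraph) k : admits_complete G k -> k <= psi G.
Proof.
case: k => // k Hk; have lt := admits_complete_bound Hk.
by apply: (@leq_bigmax_cond _ _ _ (Ordinal lt)); apply/asboolP.
Qed.

Lemma psi_admits (G : sgraph) k :
  0 < k -> admits_complete G k -> 0 < psi G /\ admits_complete G (psi G).
Proof.
move=> k0 Hk; have lt := admits_complete_bound Hk.
pose P (i : 'I_(#|G|.*2).+2) := (0 < i) && `[< admits_complete G i >].
have Pk : P (Ordinal lt) by rewrite /P k0; apply/asboolP.
rewrite /psi (@bigmax_eq_arg _ (Ordinal lt) P _ Pk).
by case: arg_maxnP => // i /andP[i0 /asboolP].
Qed.

Definition identifiable_by (G : sgraph) (S : {set G}) (u v : G) : Prop :=
  [/\ u != v, ~~ sg_adj u v, [\/ S = set0, S = [set u] | S = [set v]]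
    & forall w, sg_adj u w -> sg_adj v w -> switch_neg S u w = switch_neg S v w].

(* H is obtained, up to isomorphism, from G by identifying u and v, the map f
   being the quotient map.  *)
Definition identification (G H : sgraph) (u v : G) (f : G -> H) : Prop :=
  [/\ forall a : H, exists x, f x = a,
      forall x y, f x = f y <-> [\/ x = y, x = u /\ y = v | x = v /\ y = u],
      forall a b : H,
        sg_adj a b <-> exists x y, [/\ f x = a, f y = b & sg_adj x y]
    & forall x y, sg_adj x y -> sg_neg (f x) (f y) = sg_neg x y].

Definition elementary_image (G H : sgraph) : Prop :=
  exists (S : {set G}) (u v : G), identifiable_by S u v /\
    exists f : switch S -> H, @identification (switch S) H u v f.

(* Main.v *)
(* Complete colourings pull back along the identification map, whence
   psi(H) <= psi(G).  Conversely, deleting the classes of u and v from a complete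
   colouring of G leaves at least k - 4 colours on a subgraph of H, and a complete
   colouring of an induced subgraph extends to the whole graph without losing
   colours, one vertex at a time.

   For the sharpness it is then enough to have psi(G) >= k and psi(H) <= k - 4.
   Every nonzero class contains an edge, hence meets every vertex cover.  H has a
   vertex cover of p + 2 "hubs", two of which are twins: adjacent to each other
   and to all the other vertices, with all triangles through both twins negative.
   All the edges between the classes of two such twins have the same sign unless
   another hub interferes, so that at most p + 1 nonzero classes are possible; for
   k even, having p + 1 of them moreover excludes a zero class.  Splitting one twin of H into two
   vertices u and v gives a graph G with p + 3 nonzero classes.  *)
Require Import Defs.
From HB Require Import structures.
From mathcomp Require Import all_boot all_order all_algebra.
From mathcomp Require Import boolp zify.
Set Implicit Arguments.
Unset Strict Implicit.
Unset Printing Implicit Defensive.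

Lemma uniq_map_inj (T1 T2 : eqType) (g : T1 -> T2) (l : seq T1) :
  uniq (map g l) -> {in l &, injective g}.
Proof.
elim: l => //= a l IH /andP[al /IH inj] x y.
rewrite !inE => /predU1P[->|xl] /predU1P[->|yl] // e; last exact: inj.
- by rewrite e map_f in al.
- by rewrite -e map_f in al.
Qed.

(** * Complete colourings as labellings, and their extension to all vertices *)

Section Labelling.
Variable G : sgraph.
Implicit Types (t : G -> bool) (c : G -> nat) (D : seq nat) (o : option nat).

Definition sgn t (x y : G) : bool := (t x (+) t y) (+) sg_neg x y.

Definition has_edge t c (s : bool) (i j : nat) : Prop :=
  exists x y : G, [/\ sg_adj x y, sgn t x y = s, c x = i & c y = j].

(* Only the classes with label in [D] are considered, the vertices with other
   labels being uncoloured; [o] is the label playing the role of the colour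
   ±0, if there is one in [D].  *)
Definition labelling t c D o : Prop :=
  [/\ uniq D, forall i, i \in D -> exists x, c x = i
    & forall s i j, i \in D -> j \in D ->
        has_edge t c s i j <-> (i == j) ==> (s && (Some i != o))].

(** A label stands for two opposite colours, except [o], which stands for one. *)
Definition ncol D o : nat := (size D).*2 - (o \in map Some D).

Definition labels (k : nat) : seq nat :=
  [seq i <- iota 0 (k./2).+1 | Posz i \in M k].

Lemma mem_labels k i : (i \in labels k) = (Posz i \in M k).
Proof.
rewrite mem_filter mem_iota add0n ltnS /=; apply: andb_idr.
by rewrite inE => /andP[].
Qed.

Lemma mem_labelsE k i : (i \in labels k) = (i <= k./2) && ((i != 0) || odd k).
Proof. by rewrite mem_labels inE. Qed.

Lemma sgnC t x y : sg_adj x y -> sgn t x y = sgn t y x.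
Proof. by move=> xy; rewrite /sgn sg_neg_sym // (addbC (t x)). Qed.

(** Switching [S] and then the vertices of negative colour amounts to a single switching [t]. *)
Lemma admitsP k : admits_complete G k <->
  exists t c, labelling t c (labels k) (Some 0) /\ forall x, c x \in labels k.
Proof.
split=> [[S [phi [col [Hv He]]]] | [t [c [[_ Dv De] cov]]]].
  pose t x := (x \in S) (+) (phi x < 0)%R.
  exists t, (fun x => `|phi x|%N); split; last first.
    by move=> x; rewrite mem_labels; move: (Hv `|phi x|%N) => /= <-; apply/existsP; exists x.
  split=> [|i|s i j].
  - by rewrite filter_uniq ?iota_uniq.
  - by rewrite mem_labels => iM; move: (Hv i); rewrite /= iM => /existsP[x /eqP]; exists x.
  - rewrite !mem_labels => iM jM; move: (He s i j); rewrite /= iM jM /=.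
    have -> : (Some i != Some 0) = (i != 0) by [].
    move=> <-; split.
      move=> [x [y [xy sxy cx cy]]]; apply/existsP; exists x; apply/existsP; exists y.
      rewrite xy cx cy !eqxx -sxy /sgn /switch_neg /= /switch_neg !inE /t !andbT.
      by apply/eqP; case: (x \in S) (y \in S) (phi x < 0)%R (phi y < 0)%R (sg_neg _ _) => [] [] [] [] [].
    move=> /existsP[x /existsP[y /and4P[xy /eqP sxy /eqP cx /eqP cy]]].
    exists x, y; split=> //; rewrite -sxy /sgn /switch_neg /= /switch_neg !inE /t.
    by case: (x \in S) (y \in S) (phi x < 0)%R (phi y < 0)%R (sg_neg _ _) => [] [] [] [] [].
exists [set x | t x], (fun x => Posz (c x)); split.
  by move=> x; rewrite -mem_labels.
split=> [i|s i j] /=.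
  rewrite -mem_labels; apply/existsP/idP => [[x /eqP <-] //|/Dv[x <-]].
  by exists x.
have sE x y : switch_neg (G := switch [set x | t x]) [set v | (Posz (c v) < 0)%R] x y
    = sgn t x y.
  by rewrite /switch_neg /= /switch_neg !inE.
rewrite -!mem_labels; apply/existsP/and3P.
  case=> x /existsP[y /and4P[xy /eqP sxy /eqP cx /eqP cy]].
  rewrite -cx -cy !cov; split=> //; rewrite cx cy.
  by apply/(De s i j); rewrite -?cx -?cy //; exists x, y; rewrite -sE.
case=> iD jD /(De s i j iD jD)[x [y [xy sxy cx cy]]].
by exists x; apply/existsP; exists y; rewrite xy sE sxy cx cy !eqxx.
Qed.

Lemma ncol_labels k : ncol (labels k) (Some 0) = k.
Proof.
rewrite /ncol (mem_map Some_inj) mem_labelsE leq0n /=.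
rewrite /labels /= inE /=; set l := [seq i <- _ | _].
have -> : l = iota 1 k./2.
  apply/all_filterP/allP => i; rewrite mem_iota add1n ltnS inE /= => /andP[i0 ->].
  by rewrite eqz_nat -lt0n i0.
by rewrite -[in RHS](odd_double_half k); case: (odd k); rewrite /= size_iota; lia.
Qed.

Lemma labelling_psi_cov t c D o :
  labelling t c D o -> (forall x, c x \in D) -> ncol D o <= psi G.
Proof.
move=> [uD Dv De] cov; apply: psi_max.
pose L := [seq i <- D | Some i != o].
pose r i := if Some i == o then 0 else (index i L).+1.
have mL i : (i \in L) = (Some i != o) && (i \in D) by rewrite mem_filter.
have r0 i : (r i == 0) = (Some i == o) by rewrite /r; case: ifP.
have rI : {in D &, injective r}.
  move=> i j iD jD; rewrite /r.
  case: ifPn => [/eqP<-|io]; first by case: ifPn => // /eqP[].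
  by case: ifPn => // jo [] /(index_inj 0); apply; rewrite mL ?io ?jo.
have sL : size D = size L + (o \in map Some D).
  have -> : (o \in map Some D) = count (fun i => Some i == o) D :> nat.
    case: o {De L r mL r0 rI} => [i|].
      rewrite (mem_map Some_inj) -(count_uniq_mem _ uD).
      by apply: eq_count.
    rewrite (_ : (None \in _) = false); last by apply/mapP => -[].
    by rewrite (@eq_count _ _ pred0) ?count_pred0.
  by rewrite size_filter addnC count_predC.
have hk : (ncol D o)./2 = size L /\ odd (ncol D o) = (o \in map Some D).
  by rewrite /ncol sL; case: (o \in _); lia.
have rD i : i \in D -> r i \in labels (ncol D o).
  move=> iD; rewrite mem_labelsE; case: hk => -> ->.
  rewrite /r; case: ifPn => [/eqP<-|io]; first by rewrite (mem_map Some_inj) iD.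
  by rewrite index_mem mL io iD.
have rS i : i \in labels (ncol D o) -> exists2 j, j \in D & r j = i.
  rewrite mem_labelsE; case: hk => -> ->; case: i => [|i] /=.
    by case/mapP => j jD oE; exists j => //; rewrite /r oE eqxx.
  rewrite andbT => il; have := mem_nth 0 il; rewrite mL => /andP[io iD].
  exists (nth 0 L i) => //; rewrite /r (negPf io) index_uniq //.
  by rewrite filter_uniq.
apply/admitsP; exists t, (r \o c); split; last by move=> x; apply: rD.
split=> [|i /rS[j /Dv[x <-] <-]|s i j /rS[i' iD <-] /rS[j' jD <-]].
- by rewrite filter_uniq ?iota_uniq.
- by exists x.
- rewrite (inj_in_eq rI) // -[Some (r i') == _]/(r i' == 0) r0 -De //.
  split=> -[x [y [xy sxy cx cy]]]; exists x, y; split=> //=; last by rewrite cy.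
  + exact: rI.
  + exact: rI.
  + by rewrite cx.
Qed.


(* An uncoloured vertex [v] either fits in an existing class, or sees every
   nonzero class with both signs.  In the latter case [v] is a new zero class if
   there is none; otherwise [v] sees the zero class, which together with [v]
   becomes a nonzero class after switching its vertices so that their edges to
   [v] are negative.  *)
Lemma labelling_step t c D o v : labelling t c D o -> c v \notin D ->
  exists t' c' D' o', [/\ labelling t' c' D' o', ncol D o <= ncol D' o',
    c' v \in D' & forall x, c x \in D -> c' x \in D'].
Proof.
move=> [uD Dv De] vD.
have nv x : c x \in D -> (x == v) = false.
  by move=> xD; apply: contraNF vD => /eqP <-.
have loop x y : sg_adj x y -> c x = c y -> c x \in D -> sgn t x y && (Some (c x) != o).
  move=> xy cxy xD; have /(De (sgn t x y) _ _ xD xD) : has_edge t c (sgn t x y) (c x) (c x).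
    by exists x, y.
  by rewrite eqxx.
(* [v] fits in the class [i] if, with switching value [b], it sends only negative edges there, and
   none at all when [i] is the zero class. *)
have [fit|nofit] := pselect (exists i b, i \in D /\ forall w, sg_adj v w -> c w = i ->
    Some i != o /\ (b (+) t w) (+) sg_neg v w).
  case: fit => i [b [iD fit]].
  pose t' x := if x == v then b else t x.
  pose c' x := if x == v then i else c x.
  have c'D x : c x \in D -> c' x = c x by move=> xD; rewrite /c' nv.
  have t'D x : c x \in D -> t' x = t x by move=> xD; rewrite /t' nv.
  exists t', c', D, o; split=> //; last 1 first.
  - by move=> x xD; rewrite c'D.
  - split=> // [j /[dup] jD /Dv[x cx]|s j l jD lD].
      by exists x; rewrite c'D cx.
    split; last first.
      move=> /(De _ _ _ jD lD)[x [y [xy sxy cx cy]]]; exists x, y.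
      by rewrite /sgn !t'D ?c'D ?cx ?cy.
    move=> [x [y [xy sxy cx cy]]]; apply/implyP => /eqP jl.
    have key a d : sg_adj a d -> c' a = j -> c' d = j -> a = v -> sgn t' a d && (Some j != o).
      move=> ad ca cd av; have dv : (d == v) = false.
        by apply: contraTF ad => /eqP ->; rewrite av sg_adj_irr.
      move: ca cd; rewrite av /c' eqxx dv => ij cdi.
      have [|io sg] := fit d _ (etrans cdi (esym ij)); first by rewrite -av.
      by rewrite -ij io /sgn /t' eqxx dv sg.
    have cy' : c' y = j by rewrite cy jl.
    have [xv|/negPf xv] := eqVneq x v; first by rewrite -sxy; apply: key.
    have [yv|/negPf yv] := eqVneq y v.
      by rewrite -sxy sgnC //; apply: key; rewrite // sg_adj_sym.
    have cx2 : c x = j by rewrite -cx /c' xv.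
    have cy2 : c y = j by rewrite -cy' /c' yv.
    have := loop x y xy (etrans cx2 (esym cy2)).
    by rewrite cx2 -sxy /sgn /t' xv yv; apply.
  - by rewrite /c' eqxx.
have both i s : i \in D -> Some i != o ->
    exists w, [/\ sg_adj v w, c w = i & sgn t v w = s].
  move=> iD io; apply: contrapT => no; apply: nofit.
  (* With this switching value, only an edge of sign [s] from [v] to the class [i] can prevent [v]
     from fitting. *)
  exists i, (t v (+) s); split=> // w vw cw; split=> //.
  apply: contrapT => bad; apply: no; exists w; split=> //; move: bad => /negP.
  by rewrite /sgn; case: (t v) (t w) s (sg_neg v w) => [] [] [] [].
have zero i : i \in D -> Some i = o -> exists2 w, sg_adj v w & c w = i.
  move=> iD io; apply: contrapT => no; apply: nofit.
  by exists i, true; split=> // w vw cw; case: no; exists w.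
have [oD|oD] := boolP (o \in map Some D).
  case/mapP: oD => z zD oz.
  pose t' x := if c x == z then ~~ (t v (+) sg_neg v x) else t x.
  pose c' x := if x == v then z else c x.
  have c'D x : c x \in D -> c' x = c x by move=> xD; rewrite /c' nv.
  have c'v : c' v = z by rewrite /c' eqxx.
  have t'v : t' v = t v by rewrite /t'; case: eqP => // cv; rewrite cv zD in vD.
  have zz x : sg_adj v x -> c' x = z -> sgn t' v x.
    move=> vx; rewrite /c'; case: eqP => [xv|_ cx]; first by rewrite xv sg_adj_irr in vx.
    by rewrite /sgn t'v /t' cx eqxx; case: (t v) (sg_neg v x) => [] [].
  have old x y : c' x = c' y -> sg_adj x y -> c' x \in D -> sgn t' x y.
    move=> cxy xy xD.
    have [xv|/negPf xv] := eqVneq x v; first by rewrite xv in xy cxy *; apply: zz; rewrite // -cxy.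
    have [yv|/negPf yv] := eqVneq y v.
      rewrite sgnC //; rewrite yv in xy cxy *; apply: zz; last by rewrite cxy.
      by rewrite sg_adj_sym.
    move: cxy xD; rewrite /c' xv yv => cxy xD.
    (* The old zero class has no inner edge, so [x] and [y] lie outside it and keep their
       switching. *)
    have /andP[sxy] := loop x y xy cxy xD.
    by rewrite oz -[Some _ == _]/(c x == z) /sgn /t' -cxy => /negPf ->.
  exists t', c', D, None; split.
  - split=> // [j /[dup] jD /Dv[x cx]|s j l jD lD]; first by exists x; rewrite c'D cx.
    rewrite andbT; split.
      move=> [x [y [xy sxy cx cy]]]; apply/implyP => /eqP jl.
      by rewrite -sxy; apply: old; rewrite ?cx ?cy.
    have [<-|/negPf jl _] /= := eqVneq j l.
      case: s => // _; have [jz|/eqP jz] := eqVneq j z.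
        have [w vw cw] := zero z zD (esym oz); exists v, w; rewrite c'v c'D cw //.
        by split=> //; apply: (zz w vw); rewrite c'D cw.
      have [|x [y [xy sxy cx cy]]] := (De true j j jD jD).2.
        by rewrite eqxx oz /=; apply/eqP => -[].
      exists x, y; rewrite !c'D ?cx ?cy //; split=> //.
      by move/eqP: jz => /negPf jz; rewrite /sgn /t' cx cy jz.
    (* The new switching may spoil the old edges at the class [z], but [v] alone provides both signs
       to every other class. *)
    have vz i : i \in D -> i != z -> exists w, [/\ sg_adj v w, c' w = i & sgn t' v w = s].
      move=> iD iz; have [|w [vw cw sw]] := both i s iD.
        by rewrite oz; apply: contraNneq iz => -[->].
      by exists w; rewrite c'D cw //; split=> //; rewrite /sgn t'v {1}/t' cw (negPf iz).
    have [jz|jz] := eqVneq j z.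
      have [|w [vw cw sw]] := vz l lD; first by rewrite eq_sym -jz jl.
      by exists v, w; rewrite jz.
    have [lz|lz] := eqVneq l z.
      have [w [vw cw sw]] := vz j jD jz.
      by exists w, v; rewrite lz sgnC sg_adj_sym.
    have [|x [y [xy sxy cx cy]]] := (De s j l jD lD).2; first by rewrite jl.
    exists x, y; rewrite !c'D ?cx ?cy //; split=> //.
    by rewrite /sgn /t' cx cy (negPf jz) (negPf lz).
  - have /negPf NoneD : None \notin map Some D by apply/mapP => -[].
    by rewrite /ncol NoneD subn0 leq_subr.
  - by rewrite c'v.
  - by move=> x xD; rewrite c'D.
have oF i : i \in D -> Some i != o.
  by move=> iD; apply: contraNneq oD => <-; rewrite (mem_map Some_inj).
pose f := (\max_x c x + \max_(i <- D) i).+1.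
have fc x : c x != f by rewrite neq_ltn ltnS (leq_trans (leq_bigmax x)) ?leq_addr.
have fD : f \notin D.
  apply/negP => /(@leq_bigmax_seq _ D xpredT id f) /(_ isT) /=.
  by rewrite /f; lia.
pose c' x := if x == v then f else c x.
have c'D x : c x \in D -> c' x = c x by move=> xD; rewrite /c' nv.
have c'v : c' v = f by rewrite /c' eqxx.
have c'f x : c' x = f -> x = v.
  by rewrite /c'; case: eqP => // _ /eqP; rewrite (negPf (fc x)).
have fE i : i \in D -> (i == f) = false by move=> iD; apply: contraNF fD => /eqP <-.
exists t, c', (f :: D), (Some f); split.
- split=> [|j|s j l]; first by rewrite /= fD.
    rewrite inE => /predU1P[->|/[dup] jD /Dv[x cx]]; first by exists v.
    by exists x; rewrite c'D cx.
  rewrite !inE => /predU1P[->|jD] /predU1P[->|lD].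
  + rewrite !eqxx andbF; split=> // -[x [y [xy _ /c'f xv /c'f yv]]].
    by rewrite xv yv sg_adj_irr in xy.
  + rewrite eq_sym fE //; split=> // _.
    have [w [vw cw sw]] := both l s lD (oF l lD).
    by exists v, w; rewrite (c'D w) cw.
  + rewrite fE //; split=> // _.
    have [w [vw cw sw]] := both j s jD (oF j jD).
    by exists w, v; rewrite sgnC sg_adj_sym // (c'D w) cw.
  + have -> : (Some j != Some f) = (Some j != o).
      by rewrite oF // -[Some j == _]/(j == f) fE.
    rewrite -De //; split=> -[x [y [xy sxy cx cy]]]; exists x, y.
      move: cx cy; rewrite /c'; case: eqP => [_ fj|_ cx]; first by rewrite -fj (negPf fD) in jD.
      by case: eqP => [_ fj|//]; rewrite -fj (negPf fD) in lD.
    by rewrite !c'D ?cx ?cy.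
- by rewrite /ncol (negPf oD) /= mem_head; lia.
- by rewrite c'v mem_head.
- by move=> x xD; rewrite c'D // inE xD orbT.
Qed.

(** Induction on the number of vertices labelled outside [D], which [labelling_step] decreases. *)
Lemma labelling_psi t c D o : labelling t c D o -> ncol D o <= psi G.
Proof.
have [n] := ubnP #|[pred x | c x \notin D]|.
elim: n t c D o => // n IH t c D o ltn lab.
have [/forallP cov|] := boolP [forall x, c x \in D]; first exact: labelling_psi_cov lab cov.
rewrite negb_forall => /existsP[v vD].
have [t' [c' [D' [o' [lab' le vD' sub]]]]] := labelling_step lab vD.
apply: (leq_trans le); apply: IH lab'.
rewrite -ltnS; apply: leq_trans ltn; rewrite ltnS; apply: proper_card.
apply/properP; split.
  by apply/subsetP => x; rewrite !inE; apply: contra => /sub.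
by exists v; rewrite inE ?vD'.
Qed.

Lemma psi_le m :
  (forall k, admits_complete G k -> k <= m) -> psi G <= m.
Proof. by move=> le; apply/bigmax_leqP => k /andP[_ /asboolP /le]. Qed.

End Labelling.

(** * The two bounds for an elementary image *)

Section ElementaryImage.
Variables (G H : sgraph) (S : {set G}) (u v : G) (f : switch S -> H).
Hypothesis fP : @identification (switch S) H u v f.

Lemma psi_image_le : psi H <= psi G.
Proof.
case: fP => fS fI fA fN; apply: psi_le => k /admitsP[t [c [[uD Dv De] cov]]].
apply: psi_max; apply/admitsP.
exists (fun x : G => t (f x) (+) (x \in S)), (fun x : G => c (f x)); split; last by [].
have sE (x y : G) : sg_adj x y -> sgn t (f x) (f y)
    = sgn (fun x : G => t (f x) (+) (x \in S)) x y.
  move=> xy; rewrite /sgn fN //= /switch_neg.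
  by case: (t (f x)) (t (f y)) (x \in S) (y \in S) (sg_neg _ _) => [] [] [] [] [].
split=> // [i /Dv[a <-]|s i j iD jD]; first by have [x <-] := fS a; exists x.
rewrite -De //; split=> [[x [y [xy sxy cx cy]]]|[a [b [ab sab ca cb]]]].
  exists (f x), (f y); split=> //; last by rewrite sE.
  by apply/fA; exists x, y.
have [x [y [xa yb xy]]] := (fA a b).1 ab.
by exists x, y; rewrite -sE // xa yb.
Qed.

Lemma psi_image_ge : psi G - 4 <= psi H.
Proof.
case: fP => fS fI fA fN; rewrite leq_subLR; apply: psi_le => k /admitsP[t [c [lab _]]].
rewrite -(ncol_labels k); move: (labels k) (Some 0) lab => D o [uD Dv De].
have [g gK] : exists g : H -> G, forall a, f (g a) = a.
  by have [g gP] := choice fS; exists g.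
pose D' := [seq i <- D | i \notin [:: c u; c v]].
(* A vertex outside the classes of [u] and [v] is alone in its fibre of [f], so the section [g]
   loses nothing there. *)
have outg a x : f x = a -> c (g a) \in D' -> x = g a.
  move=> xa; rewrite mem_filter !inE negb_or => /andP[/andP[gu gv] _].
  have [//|[_ gav]|[_ gau]] := (fI x (g a)).1 (etrans xa (esym (gK a))).
  - by rewrite gav eqxx in gv.
  - by rewrite gau eqxx in gu.
have out x : c x \in D' -> g (f x) = x.
  rewrite mem_filter !inE negb_or => /andP[/andP[xu xv] _].
  have [//|[_ xv']|[_ xu']] := (fI _ _).1 (gK (f x)).
  - by rewrite xv' eqxx in xv.
  - by rewrite xu' eqxx in xu.
have D'D i : i \in D' -> i \in D by rewrite mem_filter => /andP[].
have lab' : labelling (fun a => t (g a) (+) (g a \in S)) (c \o g) D' o.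
  have sE (x y : G) : sg_adj x y -> g (f x) = x -> g (f y) = y ->
      sgn (fun a => t (g a) (+) (g a \in S)) (f x) (f y) = sgn t x y.
    move=> xy gx gy; rewrite /sgn fN //= /switch_neg gx gy.
    by case: (t x) (t y) (x \in S) (y \in S) (sg_neg _ _) => [] [] [] [] [].
  split=> [|i iD|s i j iD jD]; first by rewrite filter_uniq.
    by have [x cx] := Dv _ (D'D _ iD); exists (f x); rewrite /= out cx.
  rewrite -De ?D'D //; split=> -[x [y [xy sxy /= cx cy]]].
    have [x' [y' [xa ya xy']]] := (fA x y).1 xy.
    have gx : x' = g x by apply: outg => //; rewrite cx.
    have gy : y' = g y by apply: outg => //; rewrite cy.
    exists x', y'; split=> //; rewrite ?gx ?gy // -sE -?gx -?gy ?xa ?ya //.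
  have gx : g (f x) = x by rewrite out ?cx.
  have gy : g (f y) = y by rewrite out ?cy.
  exists (f x), (f y); split; rewrite /= ?gx ?gy ?sE //.
  by apply/fA; exists x, y.
apply: leq_trans (leq_add (leqnn 4) (labelling_psi lab')).
have oD' : (o \in map Some D') ==> (o \in map Some D).
  by apply/implyP => /mapP[i /D'D iD ->]; rewrite (mem_map Some_inj).
(* At most two labels are dropped, each worth at most two colours. *)
have szD : size D <= size D' + 2.
  rewrite /D' size_filter -(count_predC (fun i => i \notin [:: c u; c v]) D) leq_add2l.
  rewrite -size_filter; apply: (@uniq_leq_size _ _ [:: c u; c v]).
    by rewrite filter_uniq.
  by move=> i; rewrite mem_filter /= negbK => /andP[].
by move: oD' szD; rewrite /ncol; do 2!case: (o \in _) => //=; lia.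
Qed.

End ElementaryImage.

(* Besides the twins, a class of the source graph consists of [Hub l], [Loop l]
   and [Link l]: [Loop l] gives the edge inside the class, and [Link l] the negative
   edges to the other classes.  [TwinLoop] gives the edge inside the class of
   [Twin false]; [Ext false n] belongs to the class of the copy [Twin true] of the
   split twin and [Ext true n] to that of the copy [None], the sign [n] being that
   of their edges to the twins (true for -).  The vertices [Zero n] form the
   zero class when [b] holds.  *)
Inductive wvert (p : nat) : Type :=
  | Twin of bool | TwinLoop | Ext of bool & bool | Zero of bool
  | Hub of 'I_p | Loop of 'I_p | Link of 'I_p.

Arguments Twin {p}.
Arguments TwinLoop {p}.
Arguments Ext {p}.
Arguments Zero {p}.

Definition wvert_code p (x : wvert p) :
    bool + (unit + (bool * bool + (bool + ('I_p + ('I_p + 'I_p))))) :=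
  match x with
  | Twin s => inl s
  | TwinLoop => inr (inl tt)
  | Ext s n => inr (inr (inl (s, n)))
  | Zero n => inr (inr (inr (inl n)))
  | Hub l => inr (inr (inr (inr (inl l))))
  | Loop l => inr (inr (inr (inr (inr (inl l)))))
  | Link l => inr (inr (inr (inr (inr (inr l)))))
  end.

Definition wvert_decode p
    (x : bool + (unit + (bool * bool + (bool + ('I_p + ('I_p + 'I_p)))))) :
    wvert p :=
  match x with
  | inl s => Twin s
  | inr (inl _) => TwinLoop
  | inr (inr (inl (s, n))) => Ext s n
  | inr (inr (inr (inl n))) => Zero n
  | inr (inr (inr (inr (inl l)))) => Hub l
  | inr (inr (inr (inr (inr (inl l))))) => Loop l
  | inr (inr (inr (inr (inr (inr l))))) => Link l
  end.

Lemma wvert_codeK p : cancel (@wvert_code p) (@wvert_decode p).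
Proof. by case. Qed.

HB.instance Definition _ p := Finite.copy (wvert p) (can_type (@wvert_codeK p)).

(** * The graphs attaining the lower bound *)

Section Witness.
Variables (p : nat) (b : bool).
Notation V := (wvert p).

Definition wadj (x y : V) : bool :=
  match x, y with
  | Twin s, Twin t => s != t
  | Twin _, _ | _, Twin _ => true
  | Hub l, Hub m => l != m
  | Hub l, Loop m | Loop m, Hub l => l == m
  | Hub l, Link m | Link m, Hub l => m < l
  | Hub _, Zero _ | Zero _, Hub _ => b
  | _, _ => false
  end.

(** Both twins send the same sign to any other vertex, and their common edge is negative; hence all
    triangles through both are negative. *)
Definition twin_sign (x : V) : bool :=
  match x with
  | Twin _ | TwinLoop | Link _ => true
  | Ext _ n | Zero n => n
  | Hub _ | Loop _ => false
  end.

Definition wneg (x y : V) : bool :=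
  match x, y with
  | Twin _, w | w, Twin _ => twin_sign w
  | Hub _, Hub _ => false
  | Hub _, Zero n | Zero n, Hub _ => n
  | _, _ => true
  end.

Lemma wadj_sym : symmetric wadj.
Proof. by case=> [s||s n|n|l|l|l] [s'||s' n'|n'|l'|l'|l'] //=; rewrite eq_sym. Qed.

Lemma wadj_irr : irreflexive wadj.
Proof. by case=> [s||s n|n|l|l|l] //=; rewrite eqxx. Qed.

Lemma wneg_sym x y : wadj x y -> wneg x y = wneg y x.
Proof. by case: x y => [s||s n|n|l|l|l] [s'||s' n'|n'|l'|l'|l']. Qed.

Definition wimage : sgraph := SGraph wadj_sym wadj_irr wneg_sym.

(* The source graph splits the vertex [Twin true] into itself and [None], and
   distributes two of its positive edges among the two copies.  *)
Definition proj (x : option V) : V := odflt (Twin true) x.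

(** These pairs lose their edge, which would be a positive edge inside a class of [slabel]. *)
Definition wsplit (x y : option V) : bool :=
  match x, y with
  | None, Some (Ext true false) | Some (Ext true false), None
  | Some (Twin true), Some (Ext false false)
  | Some (Ext false false), Some (Twin true) => true
  | _, _ => false
  end.

Definition sadj (x y : option V) : bool := wadj (proj x) (proj y) && ~~ wsplit x y.

Lemma wsplit_sym : symmetric wsplit.
Proof.
by case=> [[[]||[] []|n|l|l|l]|] [[[]||[] []|n'|l'|l'|l']|].
Qed.

Lemma sadj_sym : symmetric sadj.
Proof. by move=> x y; rewrite /sadj wadj_sym wsplit_sym. Qed.

Lemma sadj_irr : irreflexive sadj.
Proof. by move=> x; rewrite /sadj wadj_irr. Qed.

Lemma sneg_sym x y : sadj x y -> wneg (proj x) (proj y) = wneg (proj y) (proj x).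
Proof. by case/andP => /wneg_sym. Qed.

Definition wsource : sgraph :=
  @SGraph (option V) sadj (fun x y => wneg (proj x) (proj y)) sadj_sym sadj_irr sneg_sym.

Lemma wsource_image : elementary_image wsource wimage.
Proof.
exists set0, (Some (Twin true)), None; split.
  split=> //; first by constructor.
  by move=> w _ _; rewrite /switch_neg !inE.
exists proj; split.
- by move=> a; exists (Some a).
- move=> x y; split.
    by case: x y => [x|] [y|] /=; [move->|move->|move<-|]; constructor.
  by case=> [->|[-> ->]|[-> ->]].
- move=> a d; split=> [ad|[x [y [<- <- /andP[]]]]] //.
  have [sp|nsp] := boolP (wsplit (Some a) (Some d)); last first.
    by exists (Some a), (Some d); split=> //; apply/andP.
  (* The edge missing at [Twin true] is present at its copy [None]. *)
  case: a d ad sp => [[]||[] []|n|l|l|l] [[]||[] []|n'|l'|l'|l'] // _ _.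
    by exists None, (Some (Ext false false)).
  by exists (Some (Ext false false)), None.
- by move=> x y _; rewrite /= /switch_neg !inE.
Qed.

Definition slabel (x : option V) : nat :=
  match x with
  | Some (Zero _) => 0
  | Some (Twin false) | Some TwinLoop => 1
  | Some (Twin true) | Some (Ext false _) => 2
  | None | Some (Ext true _) => 3
  | Some (Hub l) | Some (Loop l) | Some (Link l) => l.+4
  end.

Lemma wsource_labelling :
  @labelling wsource (fun _ => false) slabel
    (if b then iota 0 p.+4 else iota 1 p.+3) (Some 0).
Proof.
set D := if b then _ else _.
have edge (x y : option V) s : sadj x y -> wneg (proj x) (proj y) = s ->
    @has_edge wsource (fun _ => false) slabel s (slabel x) (slabel y).
  by move=> xy sxy; exists x, y.
have sym s i j : @has_edge wsource (fun _ => false) slabel s i j ->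
    @has_edge wsource (fun _ => false) slabel s j i.
  by case=> x [y [xy sxy cx cy]]; exists y, x; rewrite sgnC sg_adj_sym.
have DP i : i \in D ->
    [\/ i = 0 /\ b, i = 1, i = 2 | i = 3] \/ exists l : 'I_p, i = l.+4.
  case: i => [|[|[|[|i]]]]; rewrite /D.
  - by case: b => [_|]; [left; apply: Or41; split|rewrite mem_iota].
  - by left; apply: Or42.
  - by left; apply: Or43.
  - by left; apply: Or44.
  - move=> iD; have ip : i < p by case: b iD; rewrite mem_iota; lia.
    by right; exists (Ordinal ip).
split.
- by rewrite /D; case: b; rewrite iota_uniq.
- move=> i /DP[[[-> _]|->|->|->]|[l ->]].
  + by exists (Some (Zero true)).
  + by exists (Some TwinLoop).
  + by exists (Some (Twin true)).
  + by exists None.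
  + by exists (Some (Hub l)).
move=> s i j iD jD; split.
  move=> [x [y [/andP[xy sp] sxy cx cy]]]; apply/implyP => /eqP ij.
  rewrite -sxy -cx; move: sp xy (etrans cx (etrans ij (esym cy))).
  rewrite /sgn /= {sxy cx cy}.
  case: x => [[[]||[] []|n|l|l|l]|]; case: y => [[[]||[] []|n'|l'|l'|l']|] //=.
  by move=> _ /negP nll [] /val_inj ll; case: nll; rewrite ll.
have [<-|/negPf ij _] := eqVneq i j.
  case: s => //=; have [->//|i0 _] := eqVneq i 0; case: (DP i iD) => [[[i0' _]|->|->|->]|[l ->]].
  + by rewrite i0' in i0.
  + exact: (edge (Some (Twin false)) (Some TwinLoop)).
  + exact: (edge (Some (Twin true)) (Some (Ext false true))).
  + exact: (edge None (Some (Ext true true))).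
  + by apply: (edge (Some (Hub l)) (Some (Loop l))); rewrite /sadj //= eqxx.
wlog lt : i j iD jD {ij} / i < j => [th|].
  have /orP[lt|lt] : (i < j) || (j < i) by rewrite -neq_ltn ij.
    exact: th.
  by apply: sym; apply: th.
(* The zero class uses [Zero s]. Otherwise negative edges join adjacent twins or end in a [Link],
   and positive ones end in an [Ext] or join hubs; the nonadjacent copies of [Twin true] get both
   signs from [Ext true s]. *)
case: (DP j jD) lt => [[[-> _]|->|->|->]|[m ->]] //;
  case: (DP i iD) => [[[-> bT]|->|->|->]|[l ->]] // lt.
- by apply: (edge (Some (Zero s)) (Some (Twin false))).
- by apply: (edge (Some (Zero s)) (Some (Twin true))).
- case: s; first exact: (edge (Some (Twin false)) (Some (Twin true))).
  exact: (edge (Some (Twin false)) (Some (Ext false false))).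
- by apply: (edge (Some (Zero s)) None).
- case: s; first exact: (edge (Some (Twin false)) None).
  exact: (edge (Some (Twin false)) (Some (Ext true false))).
- exact: (edge (Some (Twin true)) (Some (Ext true s))).
- by apply: (edge (Some (Zero s)) (Some (Hub m))); rewrite /sadj //= bT.
- case: s; first exact: (edge (Some (Twin false)) (Some (Link m))).
  exact: (edge (Some (Twin false)) (Some (Hub m))).
- case: s; first exact: (edge (Some (Twin true)) (Some (Link m))).
  exact: (edge (Some (Twin true)) (Some (Hub m))).
- case: s; first exact: (edge None (Some (Link m))).
  exact: (edge None (Some (Hub m))).
- case: s.
    by apply: (edge (Some (Link l)) (Some (Hub m))); rewrite /sadj //= andbT.
  apply: (edge (Some (Hub l)) (Some (Hub m))) => //; rewrite /sadj /= andbT.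
  by apply: contraTneq lt => ->; rewrite ltnn.
Qed.

Lemma psi_wsource_ge : (p + 3).*2 + b <= psi wsource.
Proof.
apply: leq_trans (labelling_psi wsource_labelling).
rewrite /ncol (mem_map Some_inj); case: b; rewrite size_iota mem_iota /=; lia.
Qed.

(** * The upper bound for the image graph *)

Definition hub (x : V) : bool := if x is (Twin _ | Hub _) then true else false.

Lemma hub_cover x y : wadj x y -> hub x || hub y.
Proof. by case: x y => [s||s n|n|l|l|l] [s'||s' n'|n'|l'|l'|l']. Qed.

Definition hubs : seq V :=
  [:: Twin true, Twin false & [seq Hub l | l <- enum 'I_p]].

Lemma mem_hubs x : hub x -> x \in hubs.
Proof.
case: x => [[]|||| l||] // _; rewrite !inE /=.
by apply/mapP; exists l; rewrite ?mem_enum.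
Qed.

Lemma size_hubs : size hubs = p.+2.
Proof. by rewrite /= size_map size_enum_ord. Qed.

Section Colouring.
Variables (t : V -> bool) (c : V -> nat) (k : nat).
Hypothesis lab : @labelling wimage t c (labels k) (Some 0).
Hypothesis cov : forall x, c x \in labels k.

Lemma class_neg x y : wadj x y -> c x = c y -> @sgn wimage t x y /\ c x != 0.
Proof.
case: lab => _ _ De xy cxy.
have /(De (@sgn wimage t x y) _ _ (cov x) (cov x)) :
    @has_edge wimage t c (@sgn wimage t x y) (c x) (c x) by exists x, y.
by rewrite eqxx => /andP[].
Qed.

(* A vertex is joined to both twins by negative triangles, hence all the edges
   between the classes of the twins have the same sign.  *)
Lemma twins_close s : c (Twin s) != c (Twin (~~ s)) ->
  (forall l, c (Hub l) != c (Twin (~~ s))) ->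
  (forall l, c (Hub l) = c (Twin s) -> ~~ b /\ l = 0 :> nat) -> False.
Proof.
move=> ss hub' hub0; case: lab => _ _ De.
(* The sign of a triangle is invariant under switching. *)
have tri x y z : wadj x y -> wadj y z -> wadj x z -> wneg x y (+) wneg y z (+) wneg x z ->
    @sgn wimage t x z = ~~ (@sgn wimage t x y (+) @sgn wimage t y z).
  rewrite /sgn /= => _ _ _.
  by case: (t x) (t y) (t z) (wneg x y) (wneg y z) (wneg x z) => [] [] [] [] [] [].
(* Completeness gives an edge between the two classes with the sign opposite to that of the twin
   edge; its sign is then shown to agree. *)
have [|x [y [xy sxy cx cy]]] := (De (~~ @sgn wimage t (Twin s) (Twin (~~ s))) _ _
    (cov (Twin s)) (cov (Twin (~~ s)))).2; first by rewrite (negPf ss).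
have adjT r w : w != Twin r -> wadj (Twin r) w.
  by case: w => //= r'; apply: contraNneq => ->.
have twin_ss : wadj (Twin s) (Twin (~~ s)) by case: (s).
have sT w r : wneg (Twin r) w = twin_sign w by case: w.
have Ts w : w != Twin s -> w != Twin (~~ s) -> @sgn wimage t (Twin (~~ s)) w
    = ~~ (@sgn wimage t (Twin (~~ s)) (Twin s) (+) @sgn wimage t (Twin s) w).
  move=> w1 w2; apply: tri; [by case: (s)|exact: adjT|exact: adjT|].
  by rewrite !sT /=; case: (twin_sign w).
have ss' : @sgn wimage t (Twin (~~ s)) (Twin s) = @sgn wimage t (Twin s) (Twin (~~ s)).
  by apply: sgnC; case: (s).
have clT' w : w != Twin s -> w != Twin (~~ s) -> c w = c (Twin (~~ s)) ->
    @sgn wimage t (Twin s) w = @sgn wimage t (Twin s) (Twin (~~ s)).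
  move=> w1 w2 cw; have [neg _] := class_neg (adjT _ _ w2) (esym cw).
  by move: (Ts w w1 w2); rewrite neg ss'; do 2!case: (@sgn wimage t (Twin s) _).
have clT w : w != Twin s -> w != Twin (~~ s) -> c w = c (Twin s) ->
    @sgn wimage t (Twin (~~ s)) w = @sgn wimage t (Twin s) (Twin (~~ s)).
  move=> w1 w2 cw; have [neg _] := class_neg (adjT _ _ w1) (esym cw).
  by rewrite Ts // neg ss'; case: (@sgn wimage t (Twin s) _).
suff : @sgn wimage t x y = @sgn wimage t (Twin s) (Twin (~~ s)).
  by rewrite sxy; case: (@sgn wimage t (Twin s) _).
have xT' : x != Twin (~~ s) by apply: contraNneq ss => <-; rewrite cx.
have yT : y != Twin s by apply: contraNneq ss => <-; rewrite cy.
have [xT|xT] := eqVneq x (Twin s).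
  rewrite xT; have [->//|yT'] := eqVneq y (Twin (~~ s)); exact: clT'.
have [yT'|yT'] := eqVneq y (Twin (~~ s)).
  by rewrite sgnC // yT'; apply: clT.
have hT z : z != Twin s -> z != Twin (~~ s) -> hub z -> exists l, z = Hub l.
  case: z => // [r z1 z2|l]; last by exists l.
  by case: r s z1 z2 {ss hub' hub0 sxy cx cy yT yT' xT xT' clT clT' ss' Ts twin_ss} => [] [].
have yH : ~~ hub y.
  by apply/negP => /(hT y yT yT')[l yl]; move: (hub' l); rewrite -yl cy eqxx.
(* What remains is an edge from the hub of index 0 to a vertex that is no hub. This hub sees no
   [Link], and no [Zero] since [b] fails, so the other end is its [Loop], which forms negative
   triangles with it and the twins. *)
have [|l xl] := hT x xT xT'; first by move: (hub_cover xy); rewrite (negPf yH) orbF.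
have [nb l0] : ~~ b /\ l = 0 :> nat by apply: hub0; rewrite -xl.
have yl : y = Loop l.
  move: xy yH; rewrite xl; case: y {cy sxy yT yT'} => //= [n|m|m].
  - by rewrite (negPf nb).
  - by move=> /eqP ->.
  - by rewrite l0.
have [neg _] := class_neg (adjT _ _ yT') (esym cy).
have := clT x xT xT' cx; rewrite sgnC; last exact: adjT.
move=> sx; rewrite (tri x (Twin (~~ s)) y).
- by rewrite sx neg; case: (@sgn wimage t (Twin s) _).
- by rewrite wadj_sym adjT.
- exact: adjT.
- by [].
- by rewrite xl yl.
Qed.

End Colouring.

(** Each nonzero class contains a hub, and by [twins_close] the p + 2 hubs cannot all have distinct
    labels. So there are at most p + 1 nonzero classes, and it remains to exclude an additional zero
    class when [b] fails. *)
Lemma psi_wimage_le : 0 < p -> psi wimage <= p.+1.*2 + b.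
Proof.
move=> p0; apply: psi_le => k /admitsP[t [c [lab cov]]].
have kE := odd_double_half k.
have [_ _ De] := lab.
have Dpos i : 0 < i <= k./2 -> i \in labels k.
  by case/andP => i0 ik; rewrite mem_labelsE ik -lt0n i0.
have loop i : 0 < i <= k./2 -> exists x y, [/\ wadj x y, hub x, c x = i & c y = i].
  move=> ik; case/andP: (ik) => i0 _.
  have [|x [y [xy _ cx cy]]] := (De true _ _ (Dpos i ik) (Dpos i ik)).2.
    by rewrite eqxx -[Some i == _]/(i == 0) -lt0n.
  have /orP[h|h] := hub_cover xy; first by exists x, y.
  by exists y, x; rewrite wadj_sym.
have sub : {subset iota 1 k./2 <= map c hubs}.
  move=> i; rewrite mem_iota add1n ltnS => /loop[x [_ [_ h <- _]]].
  by rewrite map_f // mem_hubs.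
have inj_false : uniq (map c hubs) -> False.
  move=> /uniq_map_inj inj.
  have {}inj x y : c x = c y -> hub x -> hub y -> x = y.
    by move=> cxy hx hy; apply: inj => //; apply: mem_hubs.
  apply: (@twins_close t c k lab cov true) => [|l|l].
  - by apply/eqP => /inj /(_ isT isT).
  - by apply/eqP => /inj /(_ isT isT).
  - by move=> /inj /(_ isT isT).
have len : k./2 <= p.+2.
  by rewrite -size_hubs -(size_map c) -(size_iota 1 k./2) uniq_leq_size ?iota_uniq.
have [//|lt] := leqP k (p.+1.*2 + b); exfalso.
have [n2|n2] := eqVneq k./2 p.+2.
  apply/inj_false/(leq_size_uniq (iota_uniq 1 k./2) sub).
  by rewrite size_map size_hubs size_iota n2.
have [n1 ko nb] : [/\ k./2 = p.+1, odd k & ~~ b].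
  by split; move: lt kE len n2; case: b; case: (odd k) => /=; lia.
have [c0|c0] := boolP (0 \in map c hubs).
  apply/inj_false/(leq_size_uniq (iota_uniq 0 (k./2).+1)).
    case=> [//|i]; rewrite mem_iota => /andP[_ ik].
    by apply: sub; rewrite mem_iota.
  by rewrite size_map size_hubs size_iota n1.
pose h0 : V := Hub (Ordinal p0).
have cpos x : hub x -> 0 < c x <= k./2.
  move=> hx; have := cov x; rewrite mem_labelsE => /andP[-> _]; rewrite andbT lt0n.
  by apply: contraNneq c0 => <-; rewrite map_f // mem_hubs.
have nbr w : wadj h0 w -> ~~ hub w -> w = Loop (Ordinal p0).
  by case: w => //= [n|m /eqP <-] //; rewrite (negPf nb).
(* If [h0] were the only hub of its class, its [Loop] would lie in that class, to give the edge
   inside it, and also in the zero class, to give the edge between the two. *)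
have [y [hy yh0 cy]] : exists y, [/\ hub y, y != h0 & c y = c h0].
  apply: contrapT => no.
  have sole x : hub x -> c x = c h0 -> x = h0.
    move=> hx cx; have [//|xh] := eqVneq x h0.
    by case: no; exists x.
  have [x [y [xy hx /(sole _ hx) xh cy]]] := loop _ (cpos h0 isT).
  rewrite xh in xy.
  have yl : y = Loop (Ordinal p0).
    apply: nbr => //; apply/negP => /sole /(_ cy) yh.
    by rewrite yh wadj_irr in xy.
  have D0 : 0 \in labels k by rewrite mem_labelsE ko.
  have [|z [w [zw _ cz cw]]] := (De true _ _ (cov h0) D0).2.
    by case: eqP (cpos h0 isT) => // ->.
  have wh : ~~ hub w by apply/negP => /cpos; rewrite cw.
  have zh : z = h0.
    by apply: sole => //; move: (hub_cover zw); rewrite (negPf wh) orbF.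
  rewrite zh in zw; move: (cpos h0 isT).
  by rewrite -cy yl -(nbr w zw wh) cw.
(* Without [y], p + 1 hubs carry p + 1 labels, so [y] and [h0] are the only two hubs with a common
   label. *)
pose rest := rem y hubs.
have inj : uniq (map c rest).
  apply: (leq_size_uniq (iota_uniq 1 k./2)); last first.
    by rewrite size_map size_rem ?mem_hubs // size_hubs size_iota n1.
  have yP := perm_to_rem (mem_hubs hy).
  move=> i /sub; rewrite (perm_mem (perm_map c yP)) /= inE => /predU1P[->|//].
  rewrite cy map_f //; have := mem_hubs (x := h0) isT.
  by rewrite (perm_mem yP) inE eq_sym (negPf yh0).
pose rep x := if x == y then h0 else x.
have {}inj x x' : c x = c x' -> hub x -> hub x' -> rep x = rep x'.
  have cr z : hub z -> c z = c (rep z) /\ rep z \in rest.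
    have hr z' : hub z' -> z' != y -> z' \in rest.
      move=> /mem_hubs; rewrite (perm_mem (perm_to_rem (mem_hubs hy))) inE.
      by case: eqP.
    move=> hz; rewrite /rep; case: eqP => [->|/eqP zy]; last by split=> //; apply: hr.
    split; first exact: cy.
    have hh : h0 != y by move: yh0; rewrite eq_sym.
    exact: hr hh.
  move=> cxx' /cr[cx rx] /cr[cx' rx']; apply: (uniq_map_inj inj) => //.
  by rewrite -cx -cx'.
(* If [y] is a twin, only [h0] shares its label, which [twins_close] allows; otherwise neither twin
   shares its label with another hub. *)
case: y hy yh0 cy @rep inj {rest} => // [r|m] _ yh0 cy /= inj.
  apply: (@twins_close t c k lab cov r) => [|l|l].
  - by apply/eqP => /inj /(_ isT isT); rewrite eqxx; case: (r).
  - by apply/eqP => /inj /(_ isT isT); case: (r).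
  - by move=> /inj /(_ isT isT); rewrite eqxx => -[->].
have mE l : (if Hub l == Hub m then h0 else Hub l) = Hub (if l == m then Ordinal p0 else l).
  by rewrite -[Hub l == _]/(l == m); case: ifP.
apply: (@twins_close t c k lab cov true) => [|l|l].
- by apply/eqP => /inj /(_ isT isT).
- by apply/eqP => /inj /(_ isT isT); rewrite mE.
- by move=> /inj /(_ isT isT); rewrite mE.
Qed.

End Witness.

Theorem theorem3p10 :
  (forall G H : sgraph, elementary_image G H ->
     psi G - 4 <= psi H <= psi G) /\
  (forall k : nat, 8 <= k ->
     exists G H : sgraph,
       [/\ psi G = k, elementary_image G H & psi H = k - 4]).
Proof.
have bounds G H : elementary_image G H -> psi G - 4 <= psi H <= psi G.
  case=> S [u [v [_ [f fP]]]].
  by rewrite (psi_image_ge fP) (psi_image_le fP).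
(* The source then has p + 3 = [k./2] nonzero classes, and a zero class for odd [k]; [8 <= k] makes
   [p] positive. *)
split=> // k k8; pose p := k./2 - 3.
have kE := odd_double_half k.
have im := wsource_image p (odd k).
have lo := psi_wsource_ge p (odd k).
have hi : psi (wimage p (odd k)) <= p.+1.*2 + odd k by apply: psi_wimage_le; lia.
have /andP[b1 b2] := bounds _ _ im.
exists (wsource p (odd k)), (wimage p (odd k)); split=> //; lia.
Qed.
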